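(* Let $\alpha_0,\alpha_1\in\mathbb{C}$ with $\alpha_0+\alpha_1=1$, and consider the Hamiltonian system $$\frac{dx}{dt}=\frac{\partial H}{\partial y},\quad \frac{dy}{dt}=-\frac{\partial H}{\partial x},\quad \frac{dz}{dt}=\frac{\partial H}{\partial w},\quad \frac{dw}{dt}=-\frac{\partial H}{\partial z}$$ with $$H=xy^2+x^2+tx-\alpha_0 y+\frac{z^2}{4}-\frac{w^2}{4}+yzw .$$ This system has the following invariant divisors: if $\alpha_0=0$, then $f_0:=x+z^2$ is an invariant divisor; if $\alpha_1=0$, then $f_1:=x+y^2+w^2+t$ is an invariant divisor.
   Context: A polynomial $f\in\mathbb{C}(t)[x,y,z,w]$ is called an invariant divisor of the system if its total derivative along the system, $\frac{df}{dt}=\frac{\partial f}{\partial t}+\frac{\partial f}{\partial x}\frac{dx}{dt}+\frac{\partial f}{\partial y}\frac{dy}{dt}+\frac{\partial f}{\partial z}\frac{dz}{dt}+\frac{\partial f}{\partial w}\frac{dw}{dt}$, is divisible by $f$ in $\mathbb{C}(t)[x,y,z,w]$ (so that $\{f=0\}$ is preserved by the flow). *)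

(* Defs.v *)
From HB Require Import structures.
From mathcomp Require Import all_boot all_order all_algebra.
From mathcomp Require Import fraction generic_quotient ring.
From mathcomp Require Import complex reals.
From mathcomp Require Import mpoly.

Set Implicit Arguments.
Unset Strict Implicit.
Unset Printing Implicit Defensive.

Import GRing.Theory.
Local Open Scope ring_scope.
Local Open Scope quotient_scope.

Notation "x %:F" := (FracField.tofrac x) : ring_scope.

Section RatFunDeriv.
Variable K : fieldType.
Implicit Types (n d : {poly K}) (q : {fraction {poly K}}).

(* d/dt on K(t): quotient rule applied to the representative chosen by [repr];
   [fderiv_frac] shows that the choice is irrelevant. *)
Definition fderiv q : {fraction {poly K}} :=
  let n := \n_(repr q) in let d := \d_(repr q) in
  (n^`() * d - n * d^`())%:F / (d ^+ 2)%:F.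

Lemma frac_repr q : q = (\n_(repr q))%:F / (\d_(repr q))%:F.
Proof.
have dF : (\d_(repr q))%:F != 0 by rewrite tofrac_eq0 denom_ratioP.
apply: (mulIf dF); rewrite divfK //.
rewrite -[X in X * _ = _](reprK q).
apply/eqP; rewrite piE FracField.equivfE /FracField.mulf.
by rewrite !numden_Ratio ?(oner_neq0, mulr1, denom_ratioP) // mulrC.
Qed.

Lemma fderiv_frac n d : d != 0 ->
  fderiv (n%:F / d%:F) = (n^`() * d - n * d^`())%:F / (d ^+ 2)%:F.
Proof.
move=> d0; rewrite /fderiv; set q := n%:F / d%:F.
have e0 := denom_ratioP (repr q).
have := frac_repr q; move: e0.
move: (\n_(repr q)) (\d_(repr q)) => m e e0 E.
have /eqP : n%:F / d%:F = m%:F / e%:F by rewrite -E.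
rewrite eqr_div ?tofrac_eq0 // -!tofracM tofrac_eq => /eqP NE.
apply/eqP; rewrite eqr_div ?tofrac_eq0 ?expf_neq0 // -!tofracM tofrac_eq.
have := congr1 (@deriv K) NE; rewrite !derivM => dNE.
apply/eqP.
have -> : (m^`() * e - m * e^`()) * d ^+ 2
  = (m^`() * d + m * d^`()) * (d * e) - (m * d) * (d^`() * e + e^`() * d).
  ring.
rewrite -dNE -NE; ring.
Qed.

Lemma fderiv_tofrac n : fderiv n%:F = (n^`())%:F.
Proof.
rewrite -[n%:F]divr1 -tofrac1 fderiv_frac ?oner_neq0 //.
by rewrite derivC mulr0 subr0 mulr1 expr1n tofrac1 divr1.
Qed.

End RatFunDeriv.

Section InvariantDivisor.
Variables (K : fieldType) (n : nat).
Local Notation Kt := {fraction {poly K}}.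
Implicit Types (f g : {mpoly Kt[n]}) (V : 'I_n -> {mpoly Kt[n]}).

Definition mdivides f g := exists q, g = q * f.

(* d/dt f along the system d(X_i)/dt = V i; [map_mpoly fderiv] is the partial
   derivative in t, acting on coefficients (see [mcoeff_map_fderiv]). *)
Definition total_deriv V f : {mpoly Kt[n]} :=
  map_mpoly (@fderiv K) f + \sum_(i < n) f^`M(i) * V i.

Definition invariant_divisor V f := mdivides f (total_deriv V f).

Lemma mcoeff_map_fderiv f m :
  (map_mpoly (@fderiv K) f)@_m = fderiv f@_m.
Proof.
have fd0 : fderiv (0 : Kt) = 0 by rewrite -tofrac0 fderiv_tofrac derivC.
rewrite /map_mpoly /mmap raddf_sum /=.
under eq_bigr => i _ do rewrite mmap1_id mcoeffCM mcoeffX.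
case: (boolP (m \in msupp f)) => mf.
  rewrite (bigD1_seq m) ?msupp_uniq //= eqxx mulr1 big1 ?addr0 // => i /negPf ni.
  by rewrite ni mulr0.
rewrite big_seq big1 => [|i im]; first by rewrite (memN_msupp_eq0 mf) fd0.
by case: eqP => [im'|]; rewrite ?mulr0 //; rewrite -im' im in mf.
Qed.

End InvariantDivisor.

Section System.
Variable K : fieldType.
Local Notation P := {mpoly {fraction {poly K}}[4]}.

Definition ix : 'I_4 := @Ordinal 4 0 isT.
Definition iy : 'I_4 := @Ordinal 4 1 isT.
Definition iz : 'I_4 := @Ordinal 4 2 isT.
Definition iw : 'I_4 := @Ordinal 4 3 isT.

Definition x : P := 'X_ix.
Definition y : P := 'X_iy.
Definition z : P := 'X_iz.
Definition w : P := 'X_iw.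
Definition t : P := ('X : {poly K})%:F%:MP.
Definition cst (a : K) : P := (a%:P)%:F%:MP.

(* canonical pairs (x, y) and (z, w) *)
Definition hamiltonian_field (H : P) : 'I_4 -> P :=
  tnth [tuple H^`M(iy); - H^`M(ix); H^`M(iw); - H^`M(iz)].

Definition Ham (a0 : K) : P :=
  x * y ^+ 2 + x ^+ 2 + t * x - cst a0 * y
  + cst (4^-1) * z ^+ 2 - cst (4^-1) * w ^+ 2 + y * z * w.

Definition f0 : P := x + z ^+ 2.
Definition f1 : P := x + y ^+ 2 + w ^+ 2 + t.

End System.

Arguments f0 {K}.
Arguments f1 {K}.

(* Main.v *)
(** The total derivatives factor explicitly: along the flow of [Ham 0],
    f0' = 2 y f0, and along the flow of [Ham 1] (that is, alpha1 = 0),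
    f1' = - 2 y f1. *)
Require Import Defs.
From mathcomp Require Import all_boot all_order all_algebra.
From mathcomp Require Import fraction complex reals.
From mathcomp Require Import mpoly.
From mathcomp Require Import ring.
Local Open Scope ring_scope.
Local Open Scope complex_scope.

Import GRing.Theory.

(** Writing ' for the derivative along the flow, direct computation gives f0' = 2 y f0 - alpha0 and
    f1' = - 2 y f1 + alpha1. The only obstruction to divisibility is the constant, which vanishes
    exactly in the stated case; the cofactors are 2 y and - 2 y. The coefficients 1/4 of H make the
    remaining z w terms cancel. [total_deriv_Ham] writes out the flow, and [total_deriv_f0] and
    [total_deriv_f1] carry out the two factorizations. *)

Section FderivAdditive.
Variable K : fieldType.
Local Notation Kt := {fraction {poly K}}.

Lemma frac_num_den (q : Kt) :
  exists nd : {poly K} * {poly K}, nd.2 != 0 /\ q = nd.1%:F / nd.2%:F.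
Proof.
exists (\n_(repr q), \d_(repr q)).
by split; [exact: denom_ratioP | exact: frac_repr].
Qed.

(** Since [fderiv_frac] accepts any representative, the sum can be put over the product of the two
    denominators, where the quotient rule becomes a polynomial identity. *)
Lemma fderivD : {morph @fderiv K : p q / p + q}.
Proof.
move=> p q.
have [[n1 d1] [d1N0 ->]] := frac_num_den p.
have [[n2 d2] [d2N0 ->]] := frac_num_den q.
rewrite /= in d1N0 d2N0 *.
rewrite addf_div ?tofrac_eq0 // -!tofracM -tofracD.
rewrite !fderiv_frac ?mulf_neq0 // addf_div ?tofrac_eq0 ?expf_neq0 //.
rewrite -!tofracM -tofracD; congr (_%:F / _%:F); last by rewrite exprMn.
rewrite derivD !derivM; ring.
Qed.

Lemma fderiv_nat m : fderiv (m%:R : Kt) = 0.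
Proof.
by rewrite -tofrac1 -tofracMn fderiv_tofrac -polyC_natr derivC tofrac0.
Qed.

Variable n : nat.
Implicit Types f g : {mpoly Kt[n]}.

Lemma map_fderivD f g :
  map_mpoly (@fderiv K) (f + g) =
  map_mpoly (@fderiv K) f + map_mpoly (@fderiv K) g.
Proof.
apply/mpolyP => m; rewrite mcoeff_map_fderiv (mcoeffD m f g) fderivD.
rewrite [RHS]mcoeffD; congr (_ + _); by rewrite mcoeff_map_fderiv.
Qed.

(** The coefficients of a monomial are 0 or 1, hence constant in time. *)
Lemma map_fderivX m : map_mpoly (@fderiv K) 'X_[Kt, m : 'X_{1..n}] = 0.
Proof.
by apply/mpolyP => k; rewrite mcoeff_map_fderiv mcoeffX fderiv_nat mcoeff0.
Qed.

Lemma map_fderivC (c : Kt) :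
  map_mpoly (@fderiv K) (c%:MP_[n]) = (fderiv c)%:MP_[n].
Proof.
apply/mpolyP => k; rewrite mcoeff_map_fderiv !mcoeffC.
by case: eqP => _; rewrite ?mulr1 // !mulr0 (fderiv_nat 0).
Qed.

End FderivAdditive.

Section Derivation.
Variables (A : comNzRingType) (D : {additive A -> A}).
Hypothesis derM : forall p q, D (p * q) = D p * q + p * D q.

Lemma derivation_sqr p : D (p ^+ 2) = D p * (2%:R * p).
Proof. rewrite expr2 derM; ring. Qed.

(** The Hamiltonian is differentiated once, for an arbitrary derivation; taking [D] to be [mderiv i]
    yields all four partial derivatives. *)
Lemma derivation_Ham (x y z w t c q : A) : D t = 0 -> D c = 0 -> D q = 0 ->
  D (x * y ^+ 2 + x ^+ 2 + t * x - c * y + q * z ^+ 2 - q * w ^+ 2 + y * z * w)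
  = D x * (y ^+ 2 + 2%:R * x + t) + D y * (2%:R * x * y - c + z * w)
    + D z * (2%:R * q * z + y * w) + D w * (y * z - 2%:R * q * w).
Proof.
move=> dt dc dq; rewrite !(raddfB, raddfD) /= !expr2 !derM dt dc dq.
ring.
Qed.

End Derivation.

Section System.
Variable K : fieldType.
Local Notation Kt := {fraction {poly K}}.
Local Notation P := {mpoly Kt[4]}.
Local Notation x := (x K).
Local Notation y := (y K).
Local Notation z := (z K).
Local Notation w := (w K).
Local Notation t := (t K).

Lemma mderivXi (i j : 'I_4) : ('X_j : P)^`M(i) = (i == j)%:R.
Proof.
rewrite mderivX mnm1E eq_sym; case: eqP => [->|_]; last by rewrite scale0r.
rewrite scale1r -mpolyX0; congr mpolyX.
by apply/mnmP => k; rewrite mnmBE mnm0E subnn.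
Qed.

Lemma map_fderiv_sqrX (i : 'I_4) :
  map_mpoly (@fderiv K) (('X_i : P) ^+ 2) = 0.
Proof. by rewrite mpolyXn map_fderivX. Qed.

Lemma cst_nat m : cst (m%:R : K) = m%:R.
Proof.
rewrite /cst polyC_natr tofracMn tofrac1; exact: mpolyC_nat.
Qed.

Lemma cstM (a b : K) : cst (a * b) = cst a * cst b.
Proof. by rewrite /cst polyCM tofracM; exact: mpolyCM. Qed.

(** The hypothesis excludes characteristic 2, where [4^-1] is 0 by convention. *)
Lemma quarter_cst : 4%:R != 0 :> K -> 4%:R * cst (4^-1 : K) = 1.
Proof.
move=> h; transitivity (cst 4%:R * cst (4^-1 : K)).
  by rewrite cst_nat.
by rewrite -cstM (divff h) (cst_nat 1).
Qed.

Lemma mderivt i : t^`M(i) = 0.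
Proof. exact: mderivC. Qed.

Lemma mderiv_cst i (c : K) : (cst c)^`M(i) = 0.
Proof. exact: mderivC. Qed.

Lemma mderiv_Ham a0 i :
  (Ham a0)^`M(i) =
  (i == ix)%:R * (y ^+ 2 + 2%:R * x + t)
  + (i == iy)%:R * (2%:R * x * y - cst a0 + z * w)
  + (i == iz)%:R * (2%:R * cst 4^-1 * z + y * w)
  + (i == iw)%:R * (y * z - 2%:R * cst 4^-1 * w).
Proof.
have dH := @derivation_Ham _ (mderiv i) (mderivM i)
  x y z w t (cst a0) (cst 4^-1).
by rewrite (dH (mderivt i) (mderiv_cst i _) (mderiv_cst i _)) /= !mderivXi.
Qed.

Lemma mderiv_f0 i : f0^`M(i) = (i == ix)%:R + (i == iz)%:R * (2%:R * z) :> P.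
Proof.
rewrite /f0 mderivD (@derivation_sqr _ (mderiv i) (mderivM i)).
by rewrite /= !mderivXi.
Qed.

Lemma mderiv_f1 i :
  f1^`M(i) = (i == ix)%:R + (i == iy)%:R * (2%:R * y)
             + (i == iw)%:R * (2%:R * w) :> P.
Proof.
rewrite /f1 !mderivD mderivt addr0.
rewrite !(@derivation_sqr _ (mderiv i) (mderivM i)).
by rewrite /= !mderivXi.
Qed.

Lemma map_fderiv_f0 : map_mpoly (@fderiv K) f0 = 0 :> P.
Proof.
have dx : map_mpoly (@fderiv K) x = 0 := map_fderivX K 4 _.
have dz : map_mpoly (@fderiv K) (z ^+ 2) = 0 := map_fderiv_sqrX _.
by rewrite /f0 map_fderivD dx dz addr0.
Qed.

Lemma map_fderiv_f1 : map_mpoly (@fderiv K) f1 = 1 :> P.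
Proof.
have dx : map_mpoly (@fderiv K) x = 0 := map_fderivX K 4 _.
have dy : map_mpoly (@fderiv K) (y ^+ 2) = 0 := map_fderiv_sqrX _.
have dw : map_mpoly (@fderiv K) (w ^+ 2) = 0 := map_fderiv_sqrX _.
have dt : map_mpoly (@fderiv K) t = 1.
  rewrite [LHS]map_fderivC fderiv_tofrac derivX tofrac1; exact: mpolyC1.
rewrite /f1 3!map_fderivD dx dy dw dt; ring.
Qed.

(** The bracketed sum is the Poisson bracket of [f] and [H] for the pairs (x, y) and (z, w). *)
Lemma total_deriv_hamiltonian (H f : P) :
  total_deriv (hamiltonian_field H) f =
  map_mpoly (@fderiv K) f
  + (f^`M(ix) * H^`M(iy) - f^`M(iy) * H^`M(ix)
     + f^`M(iz) * H^`M(iw) - f^`M(iw) * H^`M(iz)).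
Proof.
rewrite /total_deriv !big_ord_recl big_ord0 addr0.
have -> : lift ord0 ord0 = iy by apply: val_inj.
have -> : lift ord0 (lift ord0 ord0) = iz by apply: val_inj.
have -> : lift ord0 (lift ord0 (lift ord0 ord0)) = iw by apply: val_inj.
have -> : ord0 = ix by apply: val_inj.
have -> : hamiltonian_field H ix = H^`M(iy) by exact: tnth_nth.
have -> : hamiltonian_field H iy = - H^`M(ix) by exact: tnth_nth.
have -> : hamiltonian_field H iz = H^`M(iw) by exact: tnth_nth.
have -> : hamiltonian_field H iw = - H^`M(iz) by exact: tnth_nth.
move: (f^`M(ix)) (f^`M(iy)) (f^`M(iz)) (f^`M(iw)) => fx fy fz fw.
move: (H^`M(ix)) (H^`M(iy)) (H^`M(iz)) (H^`M(iw)) => hx hy hz hw.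
ring.
Qed.

Lemma total_deriv_Ham a0 (f : P) :
  total_deriv (hamiltonian_field (Ham a0)) f =
  map_mpoly (@fderiv K) f
  + (f^`M(ix) * (2%:R * x * y - cst a0 + z * w)
     - f^`M(iy) * (y ^+ 2 + 2%:R * x + t)
     + f^`M(iz) * (y * z - 2%:R * cst 4^-1 * w)
     - f^`M(iw) * (2%:R * cst 4^-1 * z + y * w)).
Proof.
rewrite total_deriv_hamiltonian.
(* Concrete polynomials are generalized to variables before rewriting and
   [ring], which would otherwise try to unify them by unfolding. *)
have := mderiv_Ham a0 iw; have := mderiv_Ham a0 iz.
have := mderiv_Ham a0 iy; have := mderiv_Ham a0 ix.
rewrite /=; move: (Ham a0) => H hx hy hz hw.
rewrite hx hy hz hw.
move: (f^`M(ix)) (f^`M(iy)) (f^`M(iz)) (f^`M(iw)) => fx fy fz fw.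
move: (map_mpoly _ f) (x) (y) (z) (w) (t) (cst a0) (cst 4^-1).
by move=> F X Y Z W T C Q; ring.
Qed.

Lemma total_deriv_f0 : 4%:R != 0 :> K ->
  total_deriv (hamiltonian_field (Ham 0)) f0 = 2%:R * y * f0 :> P.
Proof.
move=> /quarter_cst.
rewrite total_deriv_Ham map_fderiv_f0 (cst_nat 0).
have := mderiv_f0 iw; have := mderiv_f0 iz.
have := mderiv_f0 iy; have := mderiv_f0 ix.
have : f0 = x + z ^+ 2 by [].
rewrite /=; move: f0 => f ef fx fy fz fw.
rewrite fx fy fz fw {}ef {f fx fy fz fw}.
move: (x) (y) (z) (w) (t) (cst 4^-1) => X Y Z W T Q q4.
(* The last summand isolates the z w terms: one from the derivative of H in y, the other from 2 z
   times that in w. It vanishes by [q4]. *)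
transitivity (2%:R * Y * (X + Z ^+ 2) + Z * W * (1 - 4%:R * Q)); first by ring.
by rewrite q4; ring.
Qed.

Lemma total_deriv_f1 : 4%:R != 0 :> K ->
  total_deriv (hamiltonian_field (Ham 1)) f1 = - (2%:R * y) * f1 :> P.
Proof.
move=> /quarter_cst.
(* The explicit time derivative 1 of [f1] will cancel the -1 contributed by [cst 1]. *)
rewrite total_deriv_Ham map_fderiv_f1 (cst_nat 1).
have := mderiv_f1 iw; have := mderiv_f1 iz.
have := mderiv_f1 iy; have := mderiv_f1 ix.
have : f1 = x + y ^+ 2 + w ^+ 2 + t by [].
rewrite /=; move: f1 => f ef fx fy fz fw.
rewrite fx fy fz fw {}ef {f fx fy fz fw}.
move: (x) (y) (z) (w) (t) (cst 4^-1) => X Y Z W T Q q4.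
transitivity (- (2%:R * Y) * (X + Y ^+ 2 + W ^+ 2 + T)
              + Z * W * (1 - 4%:R * Q)); first by ring.
by rewrite q4; ring.
Qed.

End System.

Theorem proposition3p2 (R : realType) (alpha0 alpha1 : R[i])
    (halpha : alpha0 + alpha1 = 1) :
  (alpha0 = 0 -> invariant_divisor (hamiltonian_field (Ham alpha0)) f0) /\
  (alpha1 = 0 -> invariant_divisor (hamiltonian_field (Ham alpha0)) f1).
Proof.
have four_neq0 : 4%:R != 0 :> R[i] by rewrite Num.Theory.pnatr_eq0.
split=> [->|alpha1_0]; first by eexists; exact: total_deriv_f0.
(* The normalization forces [alpha0] = 1, so the Hamiltonian is [Ham 1]. *)
move: halpha; rewrite alpha1_0 addr0 => ->.
by eexists; exact: total_deriv_f1.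
Qed.
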